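(* Let $G=(V,E)$ be a locally finite connected weighted graph with measure $\mu$ satisfying $\mu(x)\ge\mu_0>0$ for all $x\in V$, and let $h:V\to\mathbb{R}$ satisfy: there is a constant $h_0>0$ with $h(x)\ge h_0$ for all $x\in V$; and for every constant $B>0$, $\sum_{x\in A_B}\mu(x)<\infty$, where $A_B=\{x\in V:h(x)\le B\}$. Then $W_h^{1,s}(V)$ is compactly embedded into $L^r(V)$ for all $1<s\le r\le\infty$.
   Context: Graph setting: $G=(V,E)$ is locally finite (each vertex lies on finitely many edges) and connected; each edge $xy\in E$ has a weight $\omega_{xy}=\omega_{yx}>0$; $y\sim x$ means $xy\in E$; $\mu:V\to(0,\infty)$. Write $\int_V u\,d\mu=\sum_{x\in V}u(x)\mu(x)$; $L^r(V)$ ($1\le r<\infty$) has norm $\|u\|_{L^r(V)}=(\int_V|u|^rd\mu)^{1/r}$ and $L^\infty(V)$ has norm $\|u\|_\infty=\sup_V|u|$. For $u:V\to\mathbb{R}$, $|\nabla u|(x)=\left(\frac{1}{2\mu(x)}\sum_{y\sim x}\omega_{xy}(u(y)-u(x))^2\right)^{1/2}$. $C_c(V)$ is the set of finitely supported functions on $V$; for $s>1$, $W^{1,s}(V)$ is the completion of $C_c(V)$ under $\left(\int_V|\nabla u|^s+|u|^sd\mu\right)^{1/s}$ (a space of functions on $V$), and $W_h^{1,s}(V)=\{u\in W^{1,s}(V):\int_Vh|u|^sd\mu<\infty\}$ with norm $\|u\|_{W_h^{1,s}(V)}=\left(\int_V|\nabla u|^s+h|u|^sd\mu\right)^{1/s}$.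 *)

(* Defs.v *)
From HB Require Import structures.
From mathcomp Require Import all_boot all_order all_algebra.
From mathcomp Require Import all_classical all_reals all_analysis.
Set Implicit Arguments.
Unset Strict Implicit.
Unset Printing Implicit Defensive.
Import Order.TTheory GRing.Theory Num.Theory.
Import numFieldNormedType.Exports.
Local Open Scope classical_set_scope.
Local Open Scope ring_scope.

Record weighted_graph (R : realType) (V : choiceType) := WeightedGraph {
  adj : rel V;
  weight : V -> V -> R;
  adj_sym : forall x y, adj x y = adj y x;
  weight_sym : forall x y, adj x y -> weight x y = weight y x;
  weight_gt0 : forall x y, adj x y -> 0 < weight x y
}.

Definition locally_finite (R : realType) (V : choiceType)
    (G : weighted_graph R V) : Prop :=
  forall x, finite_set [set y | adj G x y].

Definition connected_graph (R : realType) (V : choiceType)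
    (G : weighted_graph R V) : Prop :=
  forall x y, exists2 p : seq V, path (adj G) x p & last x p = y.

(* [esum] is a supremum of finite partial sums, so this is the integral only
   of nonnegative [f]; it is used for no other integrand below. *)
Definition integralV (R : realType) (V : choiceType) (mu : V -> R)
    (f : V -> R) : \bar R :=
  \esum_(x in [set: V]) (f x * mu x)%:E.

(* The sum is the intended one when the neighbourhood of [x] is finite;
   [\sum_(y \in A) F y] is 0 by convention if [F] has infinite support in [A]. *)
Definition gradnorm (R : realType) (V : choiceType) (G : weighted_graph R V)
    (mu : V -> R) (u : V -> R) (x : V) : R :=
  Num.sqrt ((2 * mu x)^-1 *
    \sum_(y \in [set y | adj G x y]) (weight G x y * (u y - u x) ^+ 2)).

(* As in [Lnorm], the supremum is taken in [0, +oo]: adjoining 0 only matters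
   when [V] is empty. *)
Definition normL (R : realType) (V : choiceType) (mu : V -> R) (r : \bar R)
    (u : V -> R) : \bar R :=
  match r with
  | p%:E => (integralV mu (fun x => (`|u x| `^ p)%R) `^ p^-1)%E
  | +oo%E => ereal_sup (0%E |` [set `|u x|%:E | x in [set: V]])
  | -oo%E => 0%E
  end.

Definition spaceL (R : realType) (V : choiceType) (mu : V -> R) (r : \bar R) :
    set (V -> R) :=
  [set u | (normL mu r u < +oo)%E].

Definition normWh (R : realType) (V : choiceType) (G : weighted_graph R V)
    (mu h : V -> R) (s : R) (u : V -> R) : \bar R :=
  (integralV mu (fun x => (gradnorm G mu u x `^ s + h x * `|u x| `^ s)%R)
    `^ s^-1)%E.

Definition normW (R : realType) (V : choiceType) (G : weighted_graph R V)
    (mu : V -> R) (s : R) (u : V -> R) : \bar R :=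
  (integralV mu (fun x => (gradnorm G mu u x `^ s + `|u x| `^ s)%R)
    `^ s^-1)%E.

Definition Cc (R : realType) (V : choiceType) : set (V -> R) :=
  [set u | finite_set [set x | u x != 0]].

(* [normW] controls each value [u x], and the functions with [normW] finite
   form a Banach space; the completion of [Cc] is its closure in that space. *)
Definition spaceW (R : realType) (V : choiceType) (G : weighted_graph R V)
    (mu : V -> R) (s : R) : set (V -> R) :=
  [set u | exists2 phi : nat -> V -> R, (forall n, Cc (phi n)) &
     normW G mu s (phi n \- u) @[n --> \oo] --> 0%E].

Definition spaceWh (R : realType) (V : choiceType) (G : weighted_graph R V)
    (mu h : V -> R) (s : R) : set (V -> R) :=
  [set u | spaceW G mu s u /\
     (integralV mu (fun x => h x * `|u x| `^ s)%R < +oo)%E].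

Definition compactly_embedded (R : realType) (V : choiceType)
    (X : set (V -> R)) (normX : (V -> R) -> \bar R)
    (Y : set (V -> R)) (normY : (V -> R) -> \bar R) : Prop :=
  [/\ X `<=` Y,
      exists C : R, forall u, X u -> (normY u <= C%:E * normX u)%E
    & forall u_ : nat -> V -> R, (forall n, X (u_ n)) ->
        (exists M : R, forall n, (normX (u_ n) <= M%:E)%E) ->
        exists phi : nat -> nat, {homo phi : m n / (m < n)%N} /\
        exists2 u, Y u & normY (u_ (phi n) \- u) @[n --> \oo] --> 0%E].

(* Main.v *)
Require Import Defs.
From HB Require Import structures.
From mathcomp Require Import all_boot all_order all_algebra.
From mathcomp Require Import all_classical all_reals all_analysis.
From mathcomp Require Import finmap ring.
Import Order.TTheory GRing.Theory Num.Theory.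
Import numFieldNormedType.Exports.
Local Open Scope classical_set_scope.
Local Open Scope ring_scope.

(* Only the bound on the integral of h|u|^s matters. Since mu >= mu0, each
   sublevel set A_k = {h <= k + 1} is finite, and a bounded sequence u_n of
   W_h^{1,s} is pointwise bounded, so by Tychonoff it has a cluster point u for
   pointwise convergence. Finite sums are continuous for that topology: hence u
   obeys the same weighted bound, and some subsequence has
   sum_{A_k} |u_{phi k} - u|^s mu < 1/(k+1). Off A_k, |v|^s <= h|v|^s / (k+1)
   makes the tail O(1/k). This gives convergence in L^s, and mu >= mu0 gives
   ||.||_r <= C ||.||_s for r >= s. *)

(** * Continuity of power sums for pointwise convergence *)

Lemma continuous_normr_powR (R : realType) (p : R) : 0 < p ->
  continuous (fun x : R => `|x| `^ p).
Proof.
(* Away from 0 the power is exp(p ln |x|). At 0 [powR] takes the separate value 0, and |y| < e^(1/p)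
   gives |y|^p < e directly. *)
move=> p_gt0 x; have [->|x_neq0] := eqVneq x 0.
  suff cvg0 : `|y| `^ p @[y --> (0 : R)] --> (0 : R).
    by rewrite /continuous_at normr0 powR0 ?gt_eqF.
  apply/(@cvgrPdist_lt R R R (nbhs (0 : R))) => e e_gt0.
  apply: filterS (@nbhs0_lt R R _ (powR_gt0 p^-1 e_gt0)) => y y_lt.
  rewrite sub0r normrN ger0_norm ?powR_ge0//.
  have -> : e = (e `^ p^-1) `^ p by rewrite -powRrM mulVf ?gt_eqF// powRr1//
      ltW.
  by apply: gt0_ltr_powR => //; rewrite ?nnegrE ?powR_ge0.
have cvg_exp : expR (p * ln `|y|) @[y --> x] --> expR (p * ln `|x|).
  apply: continuous_comp; last exact: continuous_expR.
  apply: cvgM; first exact: cvg_cst.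
  apply: continuous_comp; first exact: norm_continuous.
  by apply: continuous_ln; rewrite normr_gt0.
rewrite /continuous_at {2}/powR normr_eq0 (negbTE x_neq0).
apply: cvg_trans cvg_exp; apply: (@near_eq_cvg R R (nbhs x)).
have x_near : \forall y \near nbhs (x : R), y != 0.
  by apply: (@cvgr_neq0 R R R (nbhs x) _ id x) => //; exact: cvg_id.
apply: filterS x_near => y y_neq0 /=.
by rewrite /powR normr_eq0 ifN.
Qed.

Lemma continuous_sum (R : realType) (T : topologicalType) (I : Type)
    (F : I -> T -> R) (A : seq I) :
  (forall i, continuous (F i)) -> continuous (fun t => \sum_(i <- A) F i t).
Proof.
move=> F_cont; elim: A => [|i A IHA].
  by under eq_fun do rewrite big_nil; exact: cst_continuous.
under eq_fun do rewrite big_cons.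
by move=> t; apply: cvgD; [exact: F_cont|exact: IHA].
Qed.

(** Serves two functionals: the weighted sum ([c] = h mu, [w] = 0) and the distance to the cluster
    point ([c] = mu, [w] = u). Each term is continuous because evaluation at a vertex is. *)
Lemma continuous_sum_powR (R : realType) (V : choiceType) (p : R) (c w : V -> R)
    (A : seq V) : 0 < p ->
  continuous (fun f : {ptws V -> R : topologicalType} =>
    \sum_(x <- A) c x * `|f x - w x| `^ p).
Proof.
move=> p_gt0; pose T : topologicalType := {ptws V -> R : topologicalType}.
apply: (@continuous_sum R T V (fun x f => c x * `|f x - w x| `^ p)) => x f.
apply: (@continuous_comp T R R (fun g => g x)
  (fun z : R => c x * `|z - w x| `^ p)).
  exact: (@proj_continuous V (fun=> R : topologicalType) x f).
apply: cvgM; first exact: cvg_cst.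
apply: (@continuous_comp _ R R (fun y => y - w x) (fun y : R => `|y| `^ p));
  last exact: continuous_normr_powR.
by apply: cvgB; [exact: cvg_id|exact: cvg_cst].
Qed.

(** |a - b| is at most twice the larger of |a| and |b|, whose power is one of the two summands. *)
Lemma powR_normB_le (R : realType) (p a b : R) : 0 <= p ->
  `|a - b| `^ p <= 2 `^ p * (`|a| `^ p + `|b| `^ p).
Proof.
move=> p_ge0; wlog ab : a b / `|a| <= `|b|.
  move=> H; have [/H//|/ltW/H] := leP `|a| `|b|.
  by rewrite distrC [X in _ * X]addrC.
apply: (@le_trans _ _ ((2 * `|b|) `^ p)).
  apply: ge0_ler_powR; rewrite ?nnegrE ?mulr_ge0//.
  by rewrite (le_trans (ler_normB _ _))// mulr_natl mulr2n lerD2r.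
by rewrite powRM// ler_wpM2l ?powR_ge0// lerDr powR_ge0.
Qed.

(** * Integrals over the vertex set and their finite partial sums *)

(** An infinite [S] has finite subsets with more than A / c elements, hence of mass at least A, for
    every A > 0. *)
Lemma esum_lty_finite_set (R : realType) (V : choiceType) (mu : V -> R)
    (c : R) (S : set V) : 0 < c -> (forall x, c <= mu x) ->
  (\esum_(x in S) (mu x)%:E < +oo)%E -> finite_set S.
Proof.
move=> c_gt0 mu_ge; apply: contraPP => /infinite_set_fsetP S_inf.
apply/negP; rewrite -leNgt leye_eq; apply/eqP/eqyP => A A_gt0.
have [B BS sizeB] := S_inf (Num.trunc (A / c)).+1.
apply: esum_ge; exists [set` B]; first by split.
rewrite fsumEFin// fsbig_finite//= set_fsetK lee_fin.
apply: (@le_trans _ _ (\sum_(x <- B) c)); last exact: ler_sum.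
rewrite big_const_seq count_predT iter_addr_0 -mulr_natr mulrC -ler_pdivrMr//.
by rewrite (le_trans (ltW (truncnS_gt _)))// ler_nat.
Qed.

(** Reduces bounds on integrals to real inequalities between finite sums; the latter pass to
    pointwise cluster points. *)
Lemma integralV_le (R : realType) (V : choiceType) (mu f : V -> R) (b : R) :
  (integralV mu f <= b%:E)%E <->
  forall X : {fset V}, \sum_(x <- X) f x * mu x <= b.
Proof.
split=> [le_b X|le_b].
  rewrite -lee_fin (le_trans _ le_b)//; apply: esum_ge.
  exists [set` X]; first by split.
  by rewrite fsumEFin// fsbig_finite//= set_fsetK.
apply: ge_ereal_sup => _ [A [A_fin _] <-].
by rewrite fsumEFin// lee_fin fsbig_finite.
Qed.

Lemma integralV_ge0 (R : realType) (V : choiceType) (mu f : V -> R) :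
  (forall x, 0 <= mu x) -> (forall x, 0 <= f x) -> (0 <= integralV mu f)%E.
Proof. by move=> mu_ge0 f_ge0; apply: esum_ge0 => x _; rewrite lee_fin
    mulr_ge0. Qed.

Lemma le_integralV1 (R : realType) (V : choiceType) (mu f : V -> R) (b : R) x :
  (integralV mu f <= b%:E)%E -> f x * mu x <= b.
Proof. by move/integralV_le/(_ [fset x]%fset); rewrite big_seq_fset1. Qed.

(** * Comparison of the norms *)

(** A single term of the integral gives c |u x|^s <= |u x|^s mu x <= ||u||_s^s; then take s-th
    roots. *)
Lemma normr_le_normL (R : realType) (V : choiceType) (mu : V -> R) (c s : R)
    (u : V -> R) (x : V) : 0 < c -> (forall x, c <= mu x) -> 0 < s ->
  (`|u x|%:E <= (c `^ - s^-1)%:E * normL mu s%:E u)%E.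
Proof.
move=> c_gt0 mu_ge s_gt0; rewrite /normL.
have : (0 <= integralV mu (fun x => (`|u x| `^ s)%R))%E.
  apply: integralV_ge0 => y; first exact: le_trans (ltW c_gt0) (mu_ge y).
  exact: powR_ge0.
(* If the integral is infinite, so is the right-hand side, its constant being positive. *)
case Ib : (integralV _ _) => [b| |//]; last first.
  by move=> _; rewrite poweRyr ?invr_eq0 ?gt_eqF// gt0_muley ?lte_fin
      ?powR_gt0// leey.
rewrite lee_fin => b_ge0; rewrite poweR_EFin -EFinM lee_fin powRN.
rewrite mulrC ler_pdivlMr ?powR_gt0//.
have <- : (`|u x| `^ s * c) `^ s^-1 = `|u x| * c `^ s^-1.
  by rewrite powRM ?powR_ge0 ?ltW// -powRrM divff ?gt_eqF// powRr1.
apply: ge0_ler_powR; rewrite ?nnegrE ?mulr_ge0 ?powR_ge0 ?invr_ge0 ?(ltW c_gt0)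
    ?(ltW s_gt0)//.
have : `|u x| `^ s * mu x <= b.
  by apply: (@le_integralV1 _ _ mu (fun y => `|u y| `^ s)); rewrite Ib.
by move=> ux_le; apply: le_trans ux_le; rewrite ler_wpM2l ?powR_ge0.
Qed.

(** Interpolation between L^s and the sup norm: |u|^p <= (k ||u||_s)^(p - s) |u|^s, where k =
    c^(-1/s) is the constant of the pointwise bound. Summing and taking p-th roots leaves the
    constant k^((p - s) / p). *)
Lemma normL_le_normL (R : realType) (V : choiceType) (mu : V -> R) (c s : R)
    (r : \bar R) : 0 < c -> (forall x, c <= mu x) -> 0 < s -> (s%:E <= r)%E ->
  exists2 C : R, 0 < C & forall u, (normL mu r u <= C%:E * normL mu s%:E u)%E.
Proof.
move=> c_gt0 mu_ge s_gt0; case: r => [p| _|]; last by rewrite leeNy_eq.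
  rewrite lee_fin => sp; have p_gt0 := lt_le_trans s_gt0 sp.
  set k := c `^ - s^-1; have k_gt0 : 0 < k by exact: powR_gt0.
  exists (k `^ ((p - s) / p)); first exact: powR_gt0.
  move=> u; have := fun x => @normr_le_normL R V mu c s u x c_gt0 mu_ge s_gt0.
  rewrite -/k /normL.
  have : (0 <= integralV mu (fun x => (`|u x| `^ s)%R))%E.
    apply: integralV_ge0 => y; first exact: le_trans (ltW c_gt0) (mu_ge y).
    exact: powR_ge0.
  case Ib : (integralV mu (fun x => (`|u x| `^ s)%R)) => [b| |//]; last first.
    by move=> _ _; rewrite poweRyr ?invr_eq0 ?gt_eqF// gt0_muley ?lte_fin
        ?powR_gt0// leey.
  rewrite lee_fin => b_ge0; set a := b `^ s^-1 => u_le.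
  have a_ge0 : 0 <= a by exact: powR_ge0.
  have ba : b = a `^ s by rewrite /a -powRrM mulVf ?gt_eqF// powRr1.
  have Ip : (integralV mu (fun x => (`|u x| `^ p)%R) <=
      (k `^ (p - s) * a `^ p)%:E)%E.
    apply/integralV_le => X.
    have -> : k `^ (p - s) * a `^ p = (k * a) `^ (p - s) * b.
      rewrite powRM ?(ltW k_gt0)// ba -mulrA -powRD ?subrK//.
      by rewrite gt_eqF.
    apply: (@le_trans _ _ ((k * a) `^ (p - s) * \sum_(x <- X) `|u x| `^ s * mu
        x)).
      rewrite mulr_sumr ler_sum// => x _; rewrite mulrA ler_wpM2r//.
        exact: le_trans (ltW c_gt0) (mu_ge x).
      have {1}-> : p = (p - s) + s by rewrite subrK.
      rewrite powRD; last by rewrite subrK gt_eqF.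
      rewrite ler_wpM2r ?powR_ge0// ge0_ler_powR ?nnegrE ?mulr_ge0 ?subr_ge0
          ?(ltW k_gt0)//.
      by have := u_le x; rewrite poweR_EFin -EFinM lee_fin.
    rewrite ler_wpM2l ?powR_ge0//.
    have /integralV_le : (integralV mu (fun x => (`|u x| `^ s)%R) <= b%:E)%E.
      by rewrite Ib.
    exact.
  rewrite poweR_EFin -/a -EFinM.
  have <- : (k `^ (p - s) * a `^ p) `^ p^-1 = k `^ ((p - s) / p) * a.
    by rewrite powRM ?powR_ge0// -(powRrM k) -(powRrM a) divff ?gt_eqF// powRr1.
  rewrite -poweR_EFin; apply: gt0_ler_poweR => //; rewrite ?invr_ge0 ?(ltW
      p_gt0)//.
    rewrite in_itv/= leey andbT; apply: integralV_ge0 => y.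
      exact: le_trans (ltW c_gt0) (mu_ge y).
    exact: powR_ge0.
  by rewrite in_itv/= leey andbT lee_fin mulr_ge0 ?powR_ge0.
exists (c `^ - s^-1); first exact: powR_gt0.
(* The first case is the value 0 adjoined to the supremum. *)
move=> u; apply: ge_ereal_sup => _ [->|[x _ <-]].
  by rewrite mule_ge0 ?lee_fin ?powR_ge0// poweR_ge0.
exact: normr_le_normL.
Qed.

Lemma normL_ge0 (R : realType) (V : choiceType) (mu : V -> R) (r : \bar R)
    (u : V -> R) : (0 <= normL mu r u)%E.
Proof.
case: r => [p| |//]; first exact: poweR_ge0.
by apply: ereal_sup_ubound; left.
Qed.

Lemma weighted_le_normWh (R : realType) (V : choiceType)
    (G : weighted_graph R V) (mu h : V -> R) (s : R) (u : V -> R) :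
  (forall x, 0 <= mu x) -> (forall x, 0 <= h x) -> 0 < s ->
  (integralV mu (fun x => (h x * `|u x| `^ s)%R) `^ s^-1 <= normWh G mu h s
      u)%E.
Proof.
move=> mu_ge0 h_ge0 s_gt0; apply: gt0_ler_poweR.
- by rewrite invr_ge0 ltW.
- rewrite in_itv/= leey andbT; apply: integralV_ge0 => // x.
  by rewrite mulr_ge0 ?powR_ge0.
- rewrite in_itv/= leey andbT; apply: integralV_ge0 => // x.
  by rewrite addr_ge0 ?mulr_ge0 ?powR_ge0.
apply: le_esum => x _; rewrite lee_fin ler_wpM2r// lerDr; exact: powR_ge0.
Qed.

(** Termwise, |u|^s <= h |u|^s / h0; the constant is the s-th root of 1 / h0. *)
Lemma normL_le_weighted (R : realType) (V : choiceType) (mu h : V -> R)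
    (h0 s : R) (u : V -> R) :
  (forall x, 0 <= mu x) -> 0 < h0 -> (forall x, h0 <= h x) -> 0 < s ->
  (normL mu s%:E u <= (h0 `^ - s^-1)%:E *
     integralV mu (fun x => (h x * `|u x| `^ s)%R) `^ s^-1)%E.
Proof.
move=> mu_ge0 h0_gt0 h_ge s_gt0; rewrite /normL.
have h_ge0 x : 0 <= h x := le_trans (ltW h0_gt0) (h_ge x).
have : (0 <= integralV mu (fun x => (h x * `|u x| `^ s)%R))%E.
  by apply: integralV_ge0 => // x; rewrite mulr_ge0 ?powR_ge0.
case Ib : (integralV mu (fun x => (h x * `|u x| `^ s)%R)) => [b| |//]; last
    first.
  by move=> _; rewrite poweRyr ?invr_eq0 ?gt_eqF// gt0_muley ?lte_fin
      ?powR_gt0// leey.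
rewrite lee_fin => b_ge0.
have -> : ((h0 `^ - s^-1)%:E * b%:E `^ s^-1 = (b / h0)%:E `^ s^-1)%E.
  rewrite !poweR_EFin -EFinM powRN powRM ?invr_ge0 ?(ltW h0_gt0)// mulrC.
  by rewrite -(powR_inv1 (ltW h0_gt0)) -powRrM mulN1r powRN.
apply: gt0_ler_poweR; rewrite ?invr_ge0 ?(ltW s_gt0)//.
- rewrite in_itv/= leey andbT; exact: integralV_ge0.
- by rewrite in_itv/= leey andbT lee_fin divr_ge0// ltW.
apply/integralV_le => X; rewrite ler_pdivlMr// mulr_suml.
have /integralV_le/(_ X) : (integralV mu (fun x => (h x * `|u x| `^ s)%R) <=
    b%:E)%E.
  by rewrite Ib.
apply: le_trans; apply: ler_sum => x _.
by rewrite mulrC mulrA ler_wpM2r// ler_wpM2r ?powR_ge0.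
Qed.

(** * Extraction of the convergent subsequence *)

(** In the rate, the 1 pays for the sublevel set {h <= k + 1}, and 2^s (K + K) for its complement,
    with one [K] for the sequence and one for the limit. *)
Lemma exists_cvg_subsequence (R : realType) (V : choiceType) (mu h : V -> R)
    (c h0 s K : R) (u_ : nat -> V -> R) :
  0 < c -> (forall x, c <= mu x) -> 0 < h0 -> (forall x, h0 <= h x) -> 0 < s ->
  (forall B : R, 0 < B -> finite_set [set x | h x <= B]) ->
  (forall n, (integralV mu (fun x => (h x * `|u_ n x| `^ s)%R) <= K%:E)%E) ->
  exists phi : nat -> nat, {homo phi : m n / (m < n)%N} /\
  exists u : V -> R,
    (integralV mu (fun x => (h x * `|u x| `^ s)%R) <= K%:E)%E /\
    forall k, (integralV mu (fun x => (`|(u_ (phi k) \- u) x| `^ s)%R) <=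
                 ((1 + 2 `^ s * (K + K)) * k.+1%:R^-1)%:E)%E.
Proof.
move=> c_gt0 mu_ge h0_gt0 h_ge s_gt0 h_fin u_le.
have mu_ge0 x : 0 <= mu x := le_trans (ltW c_gt0) (mu_ge x).
have h_gt0 x : 0 < h x := lt_le_trans h0_gt0 (h_ge x).
have h_ge0 x : 0 <= h x := ltW (h_gt0 x).
pose T : topologicalType := {ptws V -> R : topologicalType}.
(* This radius comes from h0 c |u_n x|^s <= h x |u_n x|^s mu x <= K. *)
pose b := (K / (h0 * c)) `^ s^-1.
have u_box n x : `|u_ n x| <= b.
  have -> : `|u_ n x| = (`|u_ n x| `^ s) `^ s^-1.
    by rewrite -powRrM divff ?gt_eqF// powRr1.
  have hx : `|u_ n x| `^ s * (h0 * c) <= K.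
    have := @le_integralV1 R V mu (fun x => h x * `|u_ n x| `^ s) K x (u_le n).
    apply: le_trans; rewrite mulrCA -mulrA ler_pM ?mulr_ge0 ?powR_ge0 ?(ltW
        h0_gt0) ?(ltW c_gt0)//.
    by rewrite ler_wpM2l ?powR_ge0.
  have hc : 0 < h0 * c by rewrite mulr_gt0.
  have le_div : `|u_ n x| `^ s <= K / (h0 * c) by rewrite ler_pdivlMr.
  apply: ge0_ler_powR => //; rewrite ?nnegrE ?powR_ge0 ?invr_ge0 ?(ltW s_gt0)//.
  by apply: le_trans le_div; exact: powR_ge0.
have box_compact : compact ([set f | forall x, `[- b, b]%classic (f x)] : set
    T).
  apply: (@tychonoff V (fun=> R : topologicalType) (fun=> `[- b, b]%classic))
      => _.
  exact: segment_compact.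
have [|u [_ u_cluster]] := box_compact (u_ @ \oo) _.
  by exists 0%N => // n _ x /=; rewrite in_itv/= -ler_norml.
(* A finite sum exceeding [K] at [u] would exceed it on a neighbourhood of [u], which contains some
   [u_ n]. *)
have Fatou : (integralV mu (fun x => (h x * `|u x| `^ s)%R) <= K%:E)%E.
  apply/integralV_le => X; rewrite leNgt; apply/negP => K_lt.
  pose g (f : T) := \sum_(x <- X) (h x * mu x) * `|f x - 0| `^ s.
  have gE f : g f = \sum_(x <- X) h x * `|f x| `^ s * mu x.
    by apply: eq_bigr => x _; rewrite subr0 mulrAC.
  have g_cont : continuous g.
    exact: (@continuous_sum_powR R V s (fun x => h x * mu x) (fun=> 0) X s_gt0).
  have nbhs_gt : nbhs (u : T) (g @^-1` [set y | K < y]).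
    apply: (g_cont (u : T)); apply: open_nbhs_nbhs; split; first exact: open_gt.
    by rewrite /= gE.
  have u_range : (u_ @ \oo) (range u_) by exists 0%N => // n _ /=; exists n.
  have [f [[n _ <-] /=]] := u_cluster _ _ u_range nbhs_gt.
  by rewrite gE ltNge; have /integralV_le -> := u_le n.
have sublevel_fin k : finite_set [set x | h x <= k.+1%:R] by exact: h_fin.
pose A k := fset_set [set x | h x <= k.+1%:R].
(* The finite sum is continuous and vanishes at [u], so it is small on a neighbourhood of [u]; every
   tail of the sequence meets that neighbourhood. *)
have freq N k : exists n, (N <= n)%N /\
    \sum_(x <- A k) mu x * `|u_ n x - u x| `^ s < k.+1%:R^-1.
  pose g (f : T) := \sum_(x <- A k) mu x * `|f x - u x| `^ s.
  have g_cont : continuous g by exact: continuous_sum_powR.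
  have nbhs_lt : nbhs (u : T) (g @^-1` [set y | y < k.+1%:R^-1]).
    apply: (g_cont (u : T)); apply: open_nbhs_nbhs; split; first exact: open_lt.
    rewrite /= /g big1 ?invr_gt0// => x _.
    by rewrite subrr normr0 powR0 ?mulr0// gt_eqF.
  have u_tail : (u_ @ \oo) (u_ @` [set n | (N <= n)%N]).
    by exists N => // n /= Nn; exists n.
  have [f [[n Nn <-] /= g_lt]] := u_cluster _ _ u_tail nbhs_lt.
  by exists n.
have {freq} [F F_ge] : {F : nat -> nat -> nat & forall N k, (N <= F N k)%N /\
    \sum_(x <- A k) mu x * `|u_ (F N k) x - u x| `^ s < k.+1%:R^-1}.
  exists (fun N k => sval (cid (freq N k))) => N k; exact: svalP (cid (freq N
      k)).
(* A cluster point gives no subsequence by itself. Searching from [(phi k').+1] onwards makes [phi]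
   strictly increasing, while the precision required is that of the new index. *)
pose phi := fix phi k := if k is k'.+1 then F (phi k').+1 k else F 0%N 0%N.
have phi_small k : \sum_(x <- A k) mu x * `|u_ (phi k) x - u x| `^ s <
    k.+1%:R^-1.
  by case: k => [|k] /=; [exact: (F_ge 0 0)%N.2|exact: (F_ge (phi k).+1
      k.+1).2].
exists phi; split.
  by apply: homo_ltn => [y x z|k]; [exact: ltn_trans|exact: (F_ge (phi k).+1
      k.+1).1].
exists u; split=> // k; apply/integralV_le => X.
set v := u_ (phi k); have k_gt0 : (0 : R) < k.+1%:R by [].
rewrite (bigID (fun x => h x <= k.+1%:R))/= mulrDl mul1r lerD//.
  apply: le_trans (ltW (phi_small k)).
  (* The vertices of [X] in the sublevel set are those of [A k] lying in [X]; completing the sum to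
     all of [A k] adds nonnegative terms. *)
  rewrite -big_filter (perm_big [seq x <- A k | x \in X]); last first.
    apply: uniq_perm; rewrite ?filter_uniq// => x.
    rewrite !mem_filter in_fset_set// andbC; congr (_ && _).
    by apply/idP/idP => [hx|/set_mem//]; exact/mem_set.
  rewrite big_filter [leRHS](bigID (fun x => x \in X))/= ler_wpDr//.
    by apply: sumr_ge0 => x _; rewrite mulr_ge0 ?powR_ge0.
  by under eq_bigr do rewrite mulrC.
rewrite ler_pdivlMr// mulr_suml.
(* After multiplication by k + 1, each tail term is controlled using k + 1 < h x and the power
   inequality for a difference. The majorant is then summed over all of [X], where both weighted
   bounds apply. *)
apply: (@le_trans _ _ (\sum_(x <- X)
    2 `^ s * (h x * `|v x| `^ s * mu x + h x * `|u x| `^ s * mu x))).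
  rewrite [leRHS](bigID (fun x => h x <= k.+1%:R))/= ler_wpDl//.
    apply: sumr_ge0 => x _.
    by rewrite mulr_ge0 ?addr_ge0 ?mulr_ge0 ?powR_ge0.
  apply: ler_sum => x; rewrite -ltNge => /ltW hx.
  have -> : 2 `^ s * (h x * `|v x| `^ s * mu x + h x * `|u x| `^ s * mu x) =
      2 `^ s * (`|v x| `^ s + `|u x| `^ s) * mu x * h x by ring.
  rewrite ler_pM ?mulr_ge0 ?powR_ge0// ler_wpM2r//.
  by apply: powR_normB_le; exact: ltW.
rewrite -mulr_sumr ler_wpM2l ?powR_ge0// big_split/= lerD//.
  by have /integralV_le := u_le (phi k).
by have /integralV_le := Fatou.
Qed.

(** * The compact embedding *)

Theorem lemma2p2 (R : realType) (V : choiceType) (G : weighted_graph R V)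
    (Glf : locally_finite G) (Gconn : connected_graph G)
    (mu : V -> R) (mu0 : R) (mu0_gt0 : 0 < mu0) (mu_ge : forall x, mu0 <= mu x)
    (h : V -> R) (h0 : R) (h0_gt0 : 0 < h0) (h_ge : forall x, h0 <= h x)
    (h_sublevel : forall B : R, 0 < B ->
       (\esum_(x in [set x | (h x <= B)%R]) (mu x)%:E < +oo)%E)
    (s : R) (r : \bar R) (s_gt1 : 1 < s) (s_le_r : (s%:E <= r)%E) :
  compactly_embedded (spaceWh G mu h s) (normWh G mu h s)
                     (spaceL mu r) (normL mu r).
Proof.
have s_gt0 : 0 < s := lt_trans ltr01 s_gt1.
have mu_ge0 x : 0 <= mu x := le_trans (ltW mu0_gt0) (mu_ge x).
have h_ge0 x : 0 <= h x := le_trans (ltW h0_gt0) (h_ge x).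
have [C C_gt0 normL_r] := normL_le_normL _ _ _ _ _ _ mu0_gt0 mu_ge s_gt0 s_le_r.
pose Nh (u : V -> R) := integralV mu (fun x => (h x * `|u x| `^ s)%R).
have Nh_ge0 u : (0 <= Nh u)%E.
  by apply: integralV_ge0 => // x; rewrite mulr_ge0 ?powR_ge0.
(* Product of the constants of the two comparisons: [C] from L^s to L^r, and h0^(-1/s) from the
   weighted norm to L^s. *)
pose D := C * h0 `^ - s^-1.
have D_gt0 : 0 < D by rewrite mulr_gt0 ?powR_gt0.
have normL_Nh u : (normL mu r u <= D%:E * Nh u `^ s^-1)%E.
  apply: le_trans (normL_r u) _; rewrite EFinM -muleA lee_pmul2l//.
  exact: normL_le_weighted.
have Nh_spaceL u : (Nh u < +oo)%E -> spaceL mu r u.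
  move=> Nhu; apply: le_lt_trans (normL_Nh u) _.
  by rewrite lte_mul_pinfty ?lee_fin ?(ltW D_gt0)// poweR_lty.
split=> [u [_ /Nh_spaceL]//| |u_ _ [M u_le]].
  exists D => u _; apply: le_trans (normL_Nh u) _.
  rewrite lee_pmul2l//; exact: weighted_le_normWh.
have Nh_le n : (Nh (u_ n) <= (M `^ s)%:E)%E.
  have Nh_M : (Nh (u_ n) `^ s^-1 <= M%:E)%E.
    by apply: le_trans (u_le n); exact: weighted_le_normWh.
  have -> : (Nh (u_ n) = (Nh (u_ n) `^ s^-1) `^ s)%E.
    by rewrite -poweRrM mulVf ?gt_eqF// poweRe1.
  (* [M] is nonnegative because it bounds a nonnegative quantity, so taking s-th powers preserves
     the inequality. *)
  rewrite -poweR_EFin; apply: gt0_ler_poweR; rewrite ?(ltW s_gt0)//.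
    by rewrite in_itv/= leey andbT poweR_ge0.
  by rewrite in_itv/= leey andbT (le_trans _ Nh_M)// poweR_ge0.
have h_fin B : 0 < B -> finite_set [set x | h x <= B].
  by move=> /h_sublevel; exact: (esum_lty_finite_set _ _ _ mu0 _ mu0_gt0 mu_ge).
have [phi [phi_incr [u [Nhu u_cvg]]]] :=
  exists_cvg_subsequence _ _ _ _ _ _ _ _ _ mu0_gt0 mu_ge h0_gt0 h_ge s_gt0
      h_fin Nh_le.
exists phi; split=> //; exists u; first by apply: Nh_spaceL; exact: le_lt_trans
    Nhu (ltry _).
set L := 1 + _ in u_cvg.
have L_ge0 : 0 <= L by rewrite addr_ge0 ?mulr_ge0 ?addr_ge0 ?powR_ge0.
(* The majorant is C (L / (n + 1))^(1/s). The absolute value changes nothing, since L >= 0, and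
   matches the continuity lemma for powers. *)
apply: (@squeeze_cvge _ _ _ _ (fun=> 0%E) _
    (fun n => (C * `|L * n.+1%:R^-1| `^ s^-1)%:E)).
- apply: nearW => n; rewrite normL_ge0/=.
  apply: le_trans (normL_r _) _; rewrite EFinM lee_pmul2l//.
  rewrite ger0_norm ?mulr_ge0 ?invr_ge0// -poweR_EFin.
  apply: gt0_ler_poweR; rewrite ?invr_ge0 ?(ltW s_gt0)//.
  - rewrite in_itv/= leey andbT; exact: integralV_ge0.
  - by rewrite in_itv/= leey andbT lee_fin mulr_ge0 ?invr_ge0.
- exact: cvg_cst.
apply: cvg_EFin; first exact: nearW.
have -> : 0 = C * `|L * 0| `^ s^-1 :> R.
  by rewrite mulr0 normr0 powR0 ?mulr0// invr_eq0 gt_eqF.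
apply: cvgM; first exact: cvg_cst.
apply: (@continuous_cvg _ R R (\oo) _ (fun n => L * n.+1%:R^-1)
  (fun z : R => `|z| `^ s^-1)).
  by apply: continuous_normr_powR; rewrite invr_gt0.
apply: cvgM; first exact: cvg_cst.
exact: cvg_harmonic.
Qed.
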